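(* Let $A\in\mathbb{R}^{m,d}$ and let $T\subseteq\{1,\dots,d\}$. (1) If $A$ satisfies the $(\gamma,\tau)$-RNSP with respect to $T$ for some $0\le\gamma<1$ and $\tau>0$, then there exists a $\theta>0$ such that $$\mathcal{D}^{\wedge\theta}(\|\cdot\|_1,x_0)\cap\ker A=\{0\}\qquad(\ast)$$ for every $x_0\in\mathbb{R}^d$ supported on $T$. (2) If there exists a $\theta>0$ such that $(\ast)$ holds for every $x_0\in\mathbb{R}^d$ supported on $T$, then there exist $0\le\gamma<1$ and $\tau>0$ such that $A$ satisfies the $(\gamma,\tau)$-RNSP with respect to $T$.
   Context: For $0\le\gamma<1$ and $\tau>0$, $A\in\mathbb{R}^{m,d}$ satisfies the $(\gamma,\tau)$-RNSP (Robust Null-Space Property) with respect to $T$ if $\|x_T\|_1\le\gamma\|x_{T^c}\|_1+\tau\|Ax\|_2$ for every $x\in\mathbb{R}^d$, where $x_T$ is the vector equal to $x$ on the indices in $T$ and zero elsewhere, and $T^c=\{1,\dots,d\}\setminus T$. A vector is supported on $T$ if its entries outside $T$ vanish. The descent cone of $f:\mathbb{R}^d\to\mathbb{R}$ at $x_0$ is $\mathcal{D}(f,x_0)=\{\eta\in\mathbb{R}^d : \exists\tau>0,\ f(x_0+\tau\eta)\le f(x_0)\}$. For a convex cone $C\subseteq\mathbb{R}^d$ and $\theta\in[0,\pi]$, the $\theta$-expansion of $C$ is $C^{\wedge\theta}=\{0\}\cup\{x\in\mathbb{R}^d : \exists y\in C\setminus\{0\},\ \langle x,y\rangle\ge\cos(\theta)\|x\|_2\|y\|_2\}$,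 and $\mathcal{D}^{\wedge\theta}(f,x_0)=(\mathcal{D}(f,x_0))^{\wedge\theta}$. ''$\theta>0$'' means $\theta\in(0,\pi]$. *)

(* Defs.v *)
From mathcomp Require Import all_boot all_order all_algebra.
From mathcomp Require Import classical_sets reals trigo.

Set Implicit Arguments.
Unset Strict Implicit.
Unset Printing Implicit Defensive.

Import Order.TTheory GRing.Theory Num.Theory.

Local Open Scope classical_set_scope.
Local Open Scope ring_scope.

(* The library norm on matrices is the sup norm, hence the explicit l1 and l2
   norms. *)
Definition l1norm (R : realType) (d : nat) (x : 'cV[R]_d) : R :=
  \sum_(i < d) `|x i 0|.

Definition dotprod (R : realType) (d : nat) (x y : 'cV[R]_d) : R :=
  \sum_(i < d) x i 0 * y i 0.

Definition l2norm (R : realType) (d : nat) (x : 'cV[R]_d) : R :=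
  Num.sqrt (\sum_(i < d) x i 0 ^+ 2).

Definition vrestrict (R : realType) (d : nat) (T : {set 'I_d}) (x : 'cV[R]_d) :
    'cV[R]_d :=
  \col_(i < d) (if i \in T then x i 0 else 0).

Definition supported_on (R : realType) (d : nat) (T : {set 'I_d})
    (x : 'cV[R]_d) : Prop :=
  forall i : 'I_d, i \notin T -> x i 0 = 0.

(* The ranges 0 <= gamma < 1 and 0 < tau are not part of this predicate. *)
Definition RNSP (R : realType) (m d : nat) (gamma tau : R)
    (A : 'M[R]_(m, d)) (T : {set 'I_d}) : Prop :=
  forall x : 'cV[R]_d,
    l1norm (vrestrict T x)
      <= gamma * l1norm (vrestrict (~: T)%SET x) + tau * l2norm (A *m x).

(* [kermx] is the left (row) kernel; this is the right one. *)
Definition null_space (R : realType) (m d : nat) (A : 'M[R]_(m, d)) :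
    set 'cV[R]_d :=
  [set x | A *m x = 0].

Definition descent_cone (R : realType) (d : nat) (f : 'cV[R]_d -> R)
    (x0 : 'cV[R]_d) : set 'cV[R]_d :=
  [set eta | exists2 t : R, 0 < t & f (x0 + t *: eta) <= f x0].

(* Intended for convex cones [C] and angles [theta] in [0, pi]. *)
Definition expansion (R : realType) (d : nat) (theta : R)
    (C : set 'cV[R]_d) : set 'cV[R]_d :=
  [set 0] `|`
  [set x | exists2 y, (C `\ 0) y
         & cos theta * l2norm x * l2norm y <= dotprod x y].

Definition expanded_descent_cone (R : realType) (d : nat) (theta : R)
    (f : 'cV[R]_d -> R) (x0 : 'cV[R]_d) : set 'cV[R]_d :=
  expansion theta (descent_cone f x0).

(* Main.v *)
Require Import Defs.
From mathcomp Require Import all_boot all_order all_algebra.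
From mathcomp Require Import classical_sets reals trigo.
From mathcomp Require Import ring lra.

Set Implicit Arguments.
Unset Strict Implicit.
Unset Printing Implicit Defensive.

Local Open Scope classical_set_scope.
Local Open Scope ring_scope.

Import Order.TTheory GRing.Theory Num.Theory.

(** Only ratios of l1 masses matter.  As [x0] ranges over the vectors supported
    on [T], the descent cones of the l1 norm fill up exactly the cone
    [K = { y | ||y_{T^c}||_1 <= ||y_T||_1 }] ([descent_cone_l1P]): descending
    from [x0] by [y] costs [||y_{T^c}||_1] and gains at most [||y_T||_1], and
    [x0 := - y_T] realises the full gain.  So the condition on expanded cones
    says that the kernel of [A] makes an angle larger than [theta] with [K].

    From the null space property to the angle: on [ker A] it reads
    [||x_T||_1 <= gamma ||x_{T^c}||_1], whereas [y] in [K] satisfies the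
    opposite inequality.  Hence such an [x] cannot be close to any [y] in [K]:
    [(1 - gamma) ||x||_1 <= 2 ||x - y||_1] ([cone_gap]).  A small angle between
    [x] and [y] would bring a positive multiple of [y] within [eps ||x||_2] of
    [x] ([small_angle_close]), and comparing the l1 and l2 norms gives a
    contradiction once [eps] is small compared with [(1 - gamma) / d].

    From the angle to the null space property: take
    [gamma := max (0, cos theta)].  If [x] in [ker A] had
    [||x_T||_1 > gamma ||x_{T^c}||_1], then [y := x_T + gamma x_{T^c}] would lie
    in [K], and it satisfies [<x, y> >= gamma ||x||_2^2] and
    [||y||_2 <= ||x||_2]; so the angle between [x] and [y] is at most [theta], a
    contradiction ([gap_on_kernel]).  No compactness argument is involved.  The
    inequality is extended from [ker A] to all [x] by subtracting from [x] the
    vector [B A x], where [B] is a generalised inverse of [A]: this leaves a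
    kernel vector, and the l1 norm of [B A x] is at most a constant times
    [||A x||_2] ([RNSP_of_kernel_gap]). *)

(** * The l1 and l2 norms *)

Section Norms.
Context (R : realType) (d : nat).
Implicit Types (x y : 'cV[R]_d) (T : {set 'I_d}) (a : R).

Lemma l1norm_ge0 x : 0 <= l1norm x.
Proof. exact: sumr_ge0. Qed.

Lemma l1norm0 : l1norm (0 : 'cV[R]_d) = 0.
Proof. by apply: big1 => i _; rewrite mxE normr0. Qed.

Lemma ler_l1normD x y : l1norm (x + y) <= l1norm x + l1norm y.
Proof.
by rewrite /l1norm -big_split ler_sum // => i _; rewrite mxE ler_normD.
Qed.

Lemma l1normZ a x : l1norm (a *: x) = `|a| * l1norm x.
Proof. by rewrite mulr_sumr; apply: eq_bigr => i _; rewrite mxE normrM. Qed.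

Lemma l1normN x : l1norm (- x) = l1norm x.
Proof. by rewrite -scaleN1r l1normZ normrN1 mul1r. Qed.

Lemma ler_coord_l1norm x i : `|x i 0| <= l1norm x.
Proof. by rewrite /l1norm (bigD1 i) //= lerDl sumr_ge0. Qed.

Lemma l2norm_ge0 x : 0 <= l2norm x.
Proof. exact: sqrtr_ge0. Qed.

Lemma sqr_l2norm x : l2norm x ^+ 2 = dotprod x x.
Proof.
rewrite sqr_sqrtr; first by apply: eq_bigr => i _; rewrite expr2.
by apply: sumr_ge0 => i _; rewrite sqr_ge0.
Qed.

Lemma ler_coord_l2norm x i : `|x i 0| <= l2norm x.
Proof.
rewrite -sqrtr_sqr ler_wsqrtr // (bigD1 i) //= lerDl.
by apply: sumr_ge0 => j _; rewrite sqr_ge0.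
Qed.

Lemma l2norm_eq0 x : l2norm x = 0 -> x = 0.
Proof.
move=> x0; apply/colP => i; apply/eqP.
by rewrite mxE -normr_le0 -x0 ler_coord_l2norm.
Qed.

Lemma l2norm_gt0 x : x != 0 -> 0 < l2norm x.
Proof.
move=> xN0; rewrite lt0r l2norm_ge0 andbT.
by apply: contraNneq xN0 => /l2norm_eq0 ->.
Qed.

Lemma l2norm_le_l1norm x : l2norm x <= l1norm x.
Proof.
rewrite -ler_sqr ?nnegrE ?l2norm_ge0 ?l1norm_ge0 // sqr_l2norm expr2.
rewrite {1}/l1norm mulr_suml ler_sum // => i _.
by rewrite -expr2 -real_normK ?num_real // expr2 ler_wpM2l ?ler_coord_l1norm.
Qed.

Lemma l1norm_le_l2norm x : l1norm x <= d%:R * l2norm x.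
Proof.
rewrite mulr_natl -[X in _ *+ X]card_ord -sumr_const ler_sum // => i _.
exact: ler_coord_l2norm.
Qed.

Lemma l2norm_le_coord x y : (forall i, `|x i 0| <= `|y i 0|) ->
  l2norm x <= l2norm y.
Proof.
move=> xy; rewrite ler_wsqrtr // ler_sum // => i _.
by rewrite -[X in X <= _]real_normK ?num_real // -[leRHS]real_normK
  ?num_real // lerXn2r ?nnegrE.
Qed.

Lemma dotprod_sqr_sub a x y :
  dotprod (x - a *: y) (x - a *: y) =
  dotprod x x - a * dotprod x y *+ 2 + a ^+ 2 * dotprod y y.
Proof.
rewrite /dotprod !mulr_sumr -sumrMnl -sumrN -!big_split /=.
by apply: eq_bigr => i _; rewrite !mxE; ring.
Qed.

Lemma vrestrictD T x y : vrestrict T (x + y) = vrestrict T x + vrestrict T y.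
Proof. by apply/colP => i; rewrite !mxE; case: ifP => _; rewrite ?addr0. Qed.

Lemma vrestrictZ T a x : vrestrict T (a *: x) = a *: vrestrict T x.
Proof. by apply/colP => i; rewrite !mxE; case: ifP => _; rewrite ?mulr0. Qed.

Lemma l1norm_split T x :
  l1norm x = l1norm (vrestrict T x) + l1norm (vrestrict (~: T)%SET x).
Proof.
rewrite /l1norm -big_split; apply: eq_bigr => i _; rewrite !mxE finset.in_setC.
by case: (i \in T); rewrite /= normr0 ?addr0 ?add0r.
Qed.

Lemma vrestrict_supported T x : supported_on T x ->
  vrestrict T x = x /\ vrestrict (~: T)%SET x = 0.
Proof.
move=> xT; split; apply/colP => i; rewrite !mxE ?finset.in_setC;
  by case: (boolP (i \in T)) => // /xT ->.
Qed.

Lemma l1norm_vrestrict_le T x : l1norm (vrestrict T x) <= l1norm x.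
Proof. by rewrite (l1norm_split T x) lerDl l1norm_ge0. Qed.

Lemma ler_l1norm_vrestrictB T x y :
  l1norm (vrestrict T x) <= l1norm (vrestrict T y) + l1norm (vrestrict T (x - y)).
Proof.
have := ler_l1normD (vrestrict T y) (vrestrict T (x - y)).
by rewrite -vrestrictD subrKC.
Qed.

End Norms.

(** * Descent cones of the l1 norm *)

(** The witness for the converse is [x0 := - y_T], from which a unit step along
    [y] cancels the whole of [x0] and leaves [y_{T^c}]. *)
Lemma descent_cone_l1P (R : realType) (d : nat) (T : {set 'I_d})
    (y : 'cV[R]_d) :
  (exists2 x0, supported_on T x0 & descent_cone (@l1norm R d) x0 y) <->
  l1norm (vrestrict (~: T)%SET y) <= l1norm (vrestrict T y).
Proof.
split=> [[x0 /vrestrict_supported[x0T x0C] [t t0]]|yK].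
  rewrite (l1norm_split T (x0 + _)) !vrestrictD !vrestrictZ x0T x0C add0r.
  rewrite l1normZ gtr0_norm // => le_x0.
  have := ler_l1normD (x0 + t *: vrestrict T y) (- (t *: vrestrict T y)).
  rewrite addrK l1normN l1normZ gtr0_norm // => le_x0t.
  by rewrite -(ler_pM2l t0); lra.
exists (- vrestrict T y); first by move=> i iT; rewrite !mxE (negPf iT) oppr0.
exists 1 => //; rewrite scale1r l1normN; apply: le_trans yK.
have -> // : - vrestrict T y + y = vrestrict (~: T)%SET y.
apply/colP => i; rewrite !mxE finset.in_setC.
by case: (i \in T); rewrite /= ?addNr ?oppr0 ?add0r.
Qed.

(** * From the null space property to an angle *)

(** The gap between the two cones: passing from [x] to [y] must raise the mass
    on [T] from at most [gamma] times to at least the mass off [T]. *)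
Lemma cone_gap (R : realType) (d : nat) (T : {set 'I_d}) (gamma : R)
    (x y : 'cV[R]_d) :
  gamma <= 1 ->
  l1norm (vrestrict T x) <= gamma * l1norm (vrestrict (~: T)%SET x) ->
  l1norm (vrestrict (~: T)%SET y) <= l1norm (vrestrict T y) ->
  (1 - gamma) * l1norm x <= 2 * l1norm (x - y).
Proof.
move=> g1 xg yK; rewrite (l1norm_split T (x - y)) (l1norm_split T x).
have := ler_l1norm_vrestrictB (~: T)%SET x y.
have := ler_l1norm_vrestrictB T y x.
rewrite -(opprB x y) -scaleN1r vrestrictZ scaleN1r l1normN.
have := l1norm_ge0 (vrestrict T x).
have := l1norm_ge0 (vrestrict (~: T)%SET x).
set p := l1norm (vrestrict T x) in xg *.
set q := l1norm (vrestrict (~: T)%SET x) in xg *.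
move=> q0 p0 hT hC.
have : (1 - gamma) * p <= (1 - gamma) * q.
  by apply: ler_wpM2l; [rewrite subr_ge0|nra].
lra.
Qed.

(** The multiple of [y] is the one with the l2 norm of [x]; the estimate is then
    the law of cosines. *)
Lemma small_angle_close (R : realType) (d : nat) (c : R) (x y : 'cV[R]_d) :
  y != 0 -> c * l2norm x * l2norm y <= dotprod x y ->
  exists2 s : R, 0 <= s &
    l2norm (x - s *: y) ^+ 2 <= 2 * (1 - c) * l2norm x ^+ 2.
Proof.
move=> /l2norm_gt0 y0 angle; exists (l2norm x / l2norm y).
  by rewrite divr_ge0 ?l2norm_ge0.
rewrite sqr_l2norm dotprod_sqr_sub -!sqr_l2norm expr_div_n.
rewrite divfK ?expf_neq0 ?gt_eqF //.
have : l2norm x / l2norm y * (c * l2norm x * l2norm y)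
       <= l2norm x / l2norm y * dotprod x y.
  by rewrite ler_wpM2l // divr_ge0 ?l2norm_ge0.
have -> : l2norm x / l2norm y * (c * l2norm x * l2norm y) = c * l2norm x ^+ 2.
  by field; rewrite gt_eqF.
lra.
Qed.

Lemma RNSP_expanded_cone (R : realType) (m d : nat) (A : 'M[R]_(m, d))
    (T : {set 'I_d}) (gamma tau : R) :
  0 <= gamma -> gamma < 1 -> RNSP gamma tau A T ->
  exists theta : R,
    [/\ 0 < theta, theta <= pi
      & forall x0 : 'cV[R]_d, supported_on T x0 ->
          expanded_descent_cone theta (@l1norm R d) x0 `&` null_space A
          = [set 0]].
Proof.
move=> g0 g1 rnsp.
(* The l1 and l2 norms differ by a factor at most [d], so [cone_gap] excludes
   distances up to [eps * l2norm x] as soon as [2 * d * eps < 1 - gamma]. *)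
pose eps : R := (1 - gamma) / (2 * d%:R + 1).
have d1 : 0 < 2 * d%:R + 1 :> R by have := ler0n R d; lra.
have epsE : eps * (2 * d%:R + 1) = 1 - gamma by rewrite divfK ?gt_eqF.
have eps0 : 0 < eps by rewrite divr_gt0 ?subr_gt0.
have eps1 : eps <= 1 by have := ler0n R d; nra.
(* By the law of cosines, this is the cosine of an angle that brings the two
   vectors within relative distance [eps]. *)
pose c : R := 1 - eps ^+ 2 / 2.
have cB : -1 <= c <= 1 by apply/andP; split; rewrite /c; nra.
have c1 : -1 <= c < 1 by apply/andP; split; rewrite /c; nra.
have [_ cosE] := acos_def cB.
exists (acos c); split; [exact: acos_gt0|exact: acos_lepi|move=> x0 x0T].
rewrite eqEsubset; split=> [x [xcone xker]|_ ->]; last first.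
  by split; [left|rewrite /null_space /= mulmx0].
case: xcone => // -[y [ycone /= /eqP yN0]]; rewrite cosE => angle.
have [s s0 close] := small_angle_close yN0 angle.
have yK : l1norm (vrestrict (~: T)%SET (s *: y)) <= l1norm (vrestrict T (s *: y)).
  rewrite !vrestrictZ !l1normZ ler_wpM2l //.
  by apply/descent_cone_l1P; exists x0.
have xg : l1norm (vrestrict T x) <= gamma * l1norm (vrestrict (~: T)%SET x).
  have := rnsp x; rewrite (xker : A *m x = 0).
  have -> : l2norm (0 : 'cV[R]_m) = 0.
    by apply/eqP; rewrite eq_le l2norm_ge0 -(l1norm0 R m) l2norm_le_l1norm.
  by rewrite mulr0 addr0.
have gap := cone_gap (ltW g1) xg yK.
have near : l2norm (x - s *: y) <= eps * l2norm x.
  rewrite -ler_sqr ?nnegrE ?(mulr_ge0 (ltW eps0)) ?l2norm_ge0 //.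
  by apply: le_trans close _; rewrite exprMn /c; lra.
apply: l2norm_eq0; apply/eqP; rewrite eq_le l2norm_ge0 andbT.
have := ler_wpM2l (ler0n R d) near.
have := l1norm_le_l2norm (x - s *: y).
have := ler_wpM2l (ltW (etrans (subr_gt0 gamma 1) g1)) (l2norm_le_l1norm x).
move=> h1 h2 h3; rewrite -(pmulr_rle0 _ eps0).
rewrite -epsE in gap h1; lra.
Qed.

(** * From an angle to the null space property *)

(** If the inequality failed, shrinking [x] by [gamma] off [T] would move it into
    one of the descent cones while turning it by an angle of cosine at least
    [gamma]. *)
Lemma gap_on_kernel (R : realType) (m d : nat) (A : 'M[R]_(m, d))
    (T : {set 'I_d}) (theta gamma : R) (x : 'cV[R]_d) :
  0 <= gamma -> gamma <= 1 -> cos theta <= gamma ->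
  (forall x0 : 'cV[R]_d, supported_on T x0 ->
     expanded_descent_cone theta (@l1norm R d) x0 `&` null_space A = [set 0]) ->
  A *m x = 0 ->
  l1norm (vrestrict T x) <= gamma * l1norm (vrestrict (~: T)%SET x).
Proof.
move=> g0 g1 cosg angle xker; rewrite leNgt; apply/negP => xg.
pose y := \col_i (if i \in T then x i 0 else gamma * x i 0).
have yT : vrestrict T y = vrestrict T x.
  by apply/colP => i; rewrite !mxE; case: (i \in T).
have yC : vrestrict (~: T)%SET y = gamma *: vrestrict (~: T)%SET x.
  by apply/colP => i; rewrite !mxE finset.in_setC; case: (i \in T); rewrite /= ?mulr0.
have /descent_cone_l1P[x0 x0T ycone] :
    l1norm (vrestrict (~: T)%SET y) <= l1norm (vrestrict T y).
  by rewrite yT yC l1normZ ger0_norm // ltW.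
have xTN0 : 0 < l1norm (vrestrict T x).
  by apply: le_lt_trans xg; rewrite mulr_ge0 ?l1norm_ge0.
have zN0 (z : 'cV[R]_d) : vrestrict T z = vrestrict T x -> z <> 0.
  move=> zT z0; move: xTN0; rewrite -zT ltNge => /negP; apply.
  by rewrite (le_trans (l1norm_vrestrict_le _ _)) // z0 l1norm0.
apply: (zN0 x) => //.
have : [set 0] x; last by [].
rewrite -(angle x0 x0T); split=> //; right; exists y.
  by split=> //; exact: zN0.
have yx : l2norm y <= l2norm x.
  apply: l2norm_le_coord => i; rewrite mxE; case: ifP => // _.
  by rewrite normrM ger0_norm // ler_piMl.
have : gamma * l2norm x ^+ 2 <= dotprod x y.
  rewrite sqr_l2norm mulr_sumr ler_sum // => i _.
  rewrite mxE; case: ifP => _; last by rewrite mulrCA.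
  by rewrite ler_piMl // -expr2 sqr_ge0.
apply: le_trans; rewrite -mulrA expr2.
apply: (@le_trans _ _ (gamma * (l2norm x * l2norm y))).
  by rewrite ler_wpM2r // mulr_ge0 ?l2norm_ge0.
by rewrite ler_wpM2l // ler_wpM2l ?l2norm_ge0.
Qed.

(** Any matrix is bounded from l2 to l1; the sum of the absolute values of its
    entries is a crude bound. *)
Lemma l1norm_mulmx_bound (R : realType) (m d : nat) (B : 'M[R]_(d, m))
    (w : 'cV[R]_m) :
  l1norm (B *m w) <= (\sum_i \sum_j `|B i j|) * l2norm w.
Proof.
rewrite mulr_suml ler_sum // => i _; rewrite mxE mulr_suml.
apply: le_trans (ler_norm_sum _ _ _) _; apply: ler_sum => j _.
by rewrite normrM ler_wpM2l ?ler_coord_l2norm.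
Qed.

(** Write [x] as a kernel vector plus [v := B A x], where [A B A = A], so that
    [A v = A x]: the error in each of the two masses is at most [l1norm v], hence
    at most a constant times the l2 norm of [A x]. *)
Lemma RNSP_of_kernel_gap (R : realType) (m d : nat) (A : 'M[R]_(m, d))
    (T : {set 'I_d}) (gamma : R) :
  0 <= gamma -> gamma <= 1 ->
  (forall x : 'cV[R]_d, A *m x = 0 ->
     l1norm (vrestrict T x) <= gamma * l1norm (vrestrict (~: T)%SET x)) ->
  exists2 tau : R, 0 < tau & RNSP gamma tau A T.
Proof.
move=> g0 g1 gap.
have [B ABA] : exists B : 'M[R]_(d, m), A *m B *m A = A.
  by exists (pinvmx A); rewrite mulmxKpV.
pose M := \sum_i \sum_j `|B i j|.
have M0 : 0 <= M by apply: sumr_ge0 => i _; apply: sumr_ge0.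
(* The summand [1] keeps this positive when [B] is zero. *)
exists (2 * M + 1); first by lra.
move=> x; pose v := B *m (A *m x).
have uker : A *m (x - v) = 0.
  by rewrite mulmxBr /v !mulmxA ABA subrr.
have vM : l1norm v <= M * l2norm (A *m x) by exact: l1norm_mulmx_bound.
have hT := ler_l1norm_vrestrictB T x (x - v).
have hC := ler_l1norm_vrestrictB (~: T)%SET (x - v) x.
rewrite subKr in hT; rewrite addrAC subrr add0r in hC.
have vT := l1norm_vrestrict_le T v.
have vC := l1norm_vrestrict_le (~: T)%SET (- v).
rewrite l1normN in vC.
have hg := ler_wpM2l g0 (le_trans hC (lerD (lexx _) vC)).
have := gap _ uker; have := l2norm_ge0 (A *m x).
have : gamma * l1norm v <= l1norm v by rewrite ler_piMl ?l1norm_ge0.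
rewrite mulrDr in hg; lra.
Qed.

Lemma expanded_cone_RNSP (R : realType) (m d : nat) (A : 'M[R]_(m, d))
    (T : {set 'I_d}) (theta : R) :
  0 < theta -> theta <= pi ->
  (forall x0 : 'cV[R]_d, supported_on T x0 ->
     expanded_descent_cone theta (@l1norm R d) x0 `&` null_space A = [set 0]) ->
  exists gamma tau : R,
    [/\ 0 <= gamma, gamma < 1, 0 < tau & RNSP gamma tau A T].
Proof.
move=> t0 tpi angle; pose gamma : R := Num.max 0 (cos theta).
have g0 : 0 <= gamma by rewrite le_max lexx.
have g1 : gamma < 1.
  by rewrite gt_max ltr01 -(cos0 R) ltr_cos // in_itv /= ?lexx ?pi_ge0 ?(ltW t0).
have cosg : cos theta <= gamma by rewrite le_max lexx orbT.
have [x /(gap_on_kernel g0 (ltW g1) cosg angle) //|tau tau0 rnsp]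
  := RNSP_of_kernel_gap (A := A) (T := T) g0 (ltW g1).
by exists gamma, tau.
Qed.

Theorem theorem19 (R : realType) (m d : nat) (A : 'M[R]_(m, d))
    (T : {set 'I_d}) :
  ((exists gamma tau : R,
      [/\ 0 <= gamma, gamma < 1, 0 < tau & RNSP gamma tau A T]) ->
   exists theta : R,
     [/\ 0 < theta, theta <= pi
       & forall x0 : 'cV[R]_d, supported_on T x0 ->
           expanded_descent_cone theta (@l1norm R d) x0 `&` null_space A = [set 0]])
  /\
  ((exists theta : R,
      [/\ 0 < theta, theta <= pi
        & forall x0 : 'cV[R]_d, supported_on T x0 ->
            expanded_descent_cone theta (@l1norm R d) x0 `&` null_space A = [set 0]]) ->
   exists gamma tau : R,
     [/\ 0 <= gamma, gamma < 1, 0 < tau & RNSP gamma tau A T]).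
Proof.
split=> [[gamma [tau [g0 g1 _ rnsp]]]|[theta [t0 tpi angle]]].
  exact: RNSP_expanded_cone g0 g1 rnsp.
exact: expanded_cone_RNSP t0 tpi angle.
Qed.
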